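(* Fix an integer $n \geq 1$, a subgroup $G \leq S_2 \wr S_n$ of the group of signed permutations, acting by signed permutations on commuting variables $u_1,\dots,u_n$ and on commuting variables $v_1,\dots,v_n$, and a multiplicity-free complex character $\chi$ of $G$. Let $R$ be any commutative $R_\chi$-algebra, let $t$ be an indeterminate, and let $f(t) = \sum_{M\ge 0} f_M t^M \in R[[t]]$ be any formal power series. Then \[ |G|\, E_\chi^{\mathbf{u}} \cdot \prod_{i=1}^n f(t u_i v_i) = |G|\, E_{\overline{\chi}}^{\mathbf{v}} \cdot \prod_{i=1}^n f(t u_i v_i) = \sum_{\mathbf{m} \in \mathbb{Z}_{\geq 0}^n} t^{|\mathbf{m}|} f_{\mathbf{m}} \cdot E_\chi^{\mathbf{u}}(\mathbf{u}^{\mathbf{m}}) \cdot E_{\overline{\chi}}^{\mathbf{v}}(\mathbf{v}^{\mathbf{m}}), \] where, for $\mathbf{m} = (m_1,\dots,m_n)$, $|\mathbf{m}| = m_1+\cdots+m_n$, $f_{\mathbf{m}} := \prod_i f_{m_i}$, $\mathbf{u}^{\mathbf{m}} := \prod_i u_i^{m_i}$ and $\mathbf{v}^{\mathbf{m}} := \prod_i v_i^{m_i}$.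
   Context: All the variables $u_1,\dots,u_n,v_1,\dots,v_n$ commute with one another; the identity is in $R[u_1,\dots,u_n,v_1,\dots,v_n][[t]]$ (in each $t$-degree $d$, inside the Segre component spanned by products of a degree-$d$ polynomial in the $u_i$ and a degree-$d$ polynomial in the $v_j$), and operators act coefficientwise in $t$. Signed permutations: every $g \in S_2 \wr S_n$ is written $g = D_g \sigma_g$, with $D_g$ a diagonal matrix with diagonal entries $(D_g)_i \in \{\pm 1\}$ and $\sigma_g \in S_n$ a permutation (matrix). The action on the $u$-variables, denoted $g^{\mathbf{u}}$, is the $R$-algebra automorphism of $R[u_1,\dots,u_n,v_1,\dots,v_n]$ with $u_i \mapsto (D_g)_{\sigma_g(i)}\, u_{\sigma_g(i)}$ and fixing every $v_j$; the action $g^{\mathbf{v}}$ is defined in the same way on the $v$-variables, fixing every $u_i$. Multiplicity-free means that $\chi$ is a sum of pairwise distinct irreducible complex characters of the finite group $G$. The ring $R_\chi \subset \mathbb{C}$ is the unital subring generated over $\mathbb{Z}$ by all values $\chi'(g)$, $g\in G$, of the irreducible constituents $\chi'$ of $\chi$. For an irreducible complex character $\chi'$ of $G$, put $E_{\chi'} := \chi'(1) \sum_{g \in G} \chi'(g)\, g^{-1}$ in the group algebra; for multiplicity-free $\chi$, put $E_\chi := \sum_{\chi'} E_{\chi'}$, the sum being over the irreducible constituents $\chi'$ of $\chi$. The operator $E_\chi^{\mathbf{u}}$ is the action of $E_\chi$ through $g \mapsto g^{\mathbf{u}}$, and $E_\chi^{\mathbf{v}}$ is its action through $g \mapsto g^{\mathbf{v}}$.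 Here $\overline{\chi}$ is the complex conjugate character. *)

(* Defs.v *)
From HB Require Import structures.
From mathcomp Require Import all_boot all_order all_algebra all_fingroup.
From mathcomp Require Import all_field all_character.
From mathcomp Require Import boolp.
From mathcomp Require Import mpoly.

Set Implicit Arguments.
Unset Strict Implicit.
Unset Printing Implicit Defensive.

Import Order.TTheory GRing.Theory Num.Theory.
Local Open Scope ring_scope.

(* The group of signed permutation matrices g = D_g s_g.  The sign vector is  *)
(* boolean: (D_g)_i = (-1) ^+ sp_sgn g i.                                     *)
Record signed_perm (n : nat) :=
  SignedPerm { sp_sgn : {ffun 'I_n -> bool}; sp_perm : 'S_n }.

Section SignedPermGroup.
Variable n : nat.

Definition sp_pair (g : signed_perm n) := (sp_sgn g, sp_perm g).
Definition sp_of_pair (x : {ffun 'I_n -> bool} * 'S_n) :=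
  SignedPerm x.1 x.2.
Lemma sp_pairK : cancel sp_pair sp_of_pair. Proof. by case. Qed.

HB.instance Definition _ := Finite.copy (signed_perm n) (can_type sp_pairK).

(* (D s)(D' s') = (D (s D' s^-1)) (s s'), where s D' s^-1 has D'_(s^-1 i) as  *)
(* its i-th diagonal entry.  MathComp composes permutations left to right,    *)
(* so the matrix product s s' is the permutation (s' * s)%g.                  *)
Definition sp_mul (g h : signed_perm n) : signed_perm n :=
  SignedPerm [ffun i => sp_sgn g i (+) sp_sgn h ((sp_perm g)^-1%g i)]
             (sp_perm h * sp_perm g)%g.
Definition sp_one : signed_perm n := SignedPerm [ffun => false] 1%g.
Definition sp_inv (g : signed_perm n) : signed_perm n :=
  SignedPerm [ffun i => sp_sgn g (sp_perm g i)] (sp_perm g)^-1%g.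

Lemma sp_mulA : associative sp_mul.
Proof.
move=> [a s] [b t] [c u]; rewrite /sp_mul /= mulgA; congr SignedPerm.
by apply/ffunP=> i; rewrite !ffunE invMg permM addbA.
Qed.

Lemma sp_mul1 : left_id sp_one sp_mul.
Proof.
move=> [a s]; rewrite /sp_mul /= mulg1; congr SignedPerm.
by apply/ffunP=> i; rewrite !ffunE invg1 perm1.
Qed.

Lemma sp_mulV : left_inverse sp_one sp_inv sp_mul.
Proof.
move=> [a s]; rewrite /sp_mul /= mulgV; congr SignedPerm.
by apply/ffunP=> i; rewrite !ffunE invgK addbb.
Qed.

HB.instance Definition _ :=
  Finite_isGroup.Build (signed_perm n) sp_mulA sp_mul1 sp_mulV.

(* The permutation matrix of s sends e_j to e_(s j), hence is perm_mx s^-1.   *)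
Definition sp_mx (g : signed_perm n) : 'M[int]_n :=
  diag_mx (\row_i (-1) ^+ sp_sgn g i) *m perm_mx (sp_perm g)^-1%g.

Lemma sp_mxE g i j :
  sp_mx g i j = (-1) ^+ sp_sgn g i * (i == sp_perm g j)%:R.
Proof.
rewrite mxE (bigD1 i) //= big1 ?addr0 => [|k ne_ki].
  rewrite !mxE eqxx mulr1n; congr (_ * _%:R).
  by rewrite -(inj_eq (@perm_inj _ (sp_perm g))) permKV.
by rewrite !mxE eq_sym (negPf ne_ki) mulr0n mul0r.
Qed.

Lemma sp_mxM (g h : signed_perm n) : sp_mx (g * h)%g = sp_mx g *m sp_mx h.
Proof.
apply/matrixP=> i k; rewrite sp_mxE mxE.
rewrite (bigD1 ((sp_perm g)^-1%g i)) //= big1 ?addr0 => [|j ne_ji].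
  rewrite !sp_mxE permKV eqxx mulr1 /= ffunE signr_addb permM -mulrA.
  rewrite -[(_ == sp_perm h k) in RHS](inj_eq (@perm_inj _ (sp_perm g))).
  by rewrite permKV.
rewrite !sp_mxE; case: eqP => [def_i|_]; last by rewrite mulr0 mul0r.
by case/eqP: ne_ji; rewrite def_i permK.
Qed.

End SignedPermGroup.

Record fps (A : Type) := Fps { fps_coef : nat -> A }.

Section FpsRing.
Variable A : comNzRingType.

Lemma fpsP (p q : fps A) : fps_coef p =1 fps_coef q -> p = q.
Proof. by case: p q => [p] [q] /= /funext ->. Qed.

HB.instance Definition _ := gen_eqMixin (fps A).
HB.instance Definition _ := gen_choiceMixin (fps A).

Definition fps_add (p q : fps A) := Fps (fun d => fps_coef p d + fps_coef q d).
Definition fps_opp (p : fps A) := Fps (fun d => - fps_coef p d).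
Definition fpsC (c : A) := Fps (fun d => if d is 0%N then c else 0).
Definition fps_mul (p q : fps A) :=
  Fps (fun d => \sum_(j < d.+1) fps_coef p j * fps_coef q (d - j)%N).
Definition fpsX : fps A := Fps (fun d => (d == 1%N)%:R).

Fact fps_addA : associative fps_add.
Proof. by move=> p q r; apply: fpsP => d /=; rewrite addrA. Qed.
Fact fps_addC : commutative fps_add.
Proof. by move=> p q; apply: fpsP => d /=; rewrite addrC. Qed.
Fact fps_add0 : left_id (fpsC 0) fps_add.
Proof. by move=> p; apply: fpsP => -[|d] /=; rewrite add0r. Qed.
Fact fps_addN : left_inverse (fpsC 0) fps_opp fps_add.
Proof. by move=> p; apply: fpsP => -[|d] /=; rewrite addNr. Qed.

HB.instance Definition _ := GRing.isZmodule.Build (fps A)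
  fps_addA fps_addC fps_add0 fps_addN.

Lemma fps_coef_mul_rev (p q : fps A) d :
  fps_coef (fps_mul p q) d =
    \sum_(j < d.+1) fps_coef p (d - j)%N * fps_coef q j.
Proof.
rewrite /= (reindex_inj rev_ord_inj) /=.
by apply: eq_bigr => i _; rewrite subSS subKn // -ltnS.
Qed.

Fact fps_mulA : associative fps_mul.
Proof.
move=> p q r; apply: fpsP => d; rewrite [RHS]fps_coef_mul_rev /=.
pose coef3 j k := fps_coef p j * (fps_coef q (d - j - k)%N * fps_coef r k).
transitivity (\sum_(j < d.+1) \sum_(k < d.+1 | (k <= d - j)%N) coef3 j k).
  apply: eq_bigr => /= j _.
  rewrite -[X in _ * X]/(fps_coef (fps_mul q r) _).
  rewrite fps_coef_mul_rev big_distrr /=.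
  by rewrite (big_ord_narrow_leq (leq_subr _ _)).
rewrite (exchange_big_dep predT) //=; apply: eq_bigr => k _.
transitivity (\sum_(j < d.+1 | (j <= d - k)%N) coef3 j k).
  apply: eq_bigl => j; rewrite -ltnS -(ltnS j) -!subSn ?leq_ord //.
  by rewrite -subn_gt0 -(subn_gt0 j) -!subnDA addnC.
rewrite (big_ord_narrow_leq (leq_subr _ _)) big_distrl /=.
by apply: eq_bigr => j _; rewrite /coef3 -!subnDA addnC mulrA.
Qed.

Fact fps_mulC : commutative fps_mul.
Proof.
move=> p q; apply: fpsP => d; rewrite fps_coef_mul_rev /=.
by apply: eq_bigr => j _; rewrite mulrC.
Qed.

Fact fps_mul1 : left_id (fpsC 1) fps_mul.
Proof.
move=> p; apply: fpsP => d /=.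
by rewrite big_ord_recl /= mul1r subn0 big1 ?addr0 // => i _; rewrite mul0r.
Qed.

Fact fps_mulDl : left_distributive fps_mul +%R.
Proof.
move=> p q r; apply: fpsP => d /=; rewrite -big_split /=.
by apply: eq_bigr => j _; rewrite mulrDl.
Qed.

Fact fps_oner_neq0 : fpsC 1 != 0 :> fps A.
Proof.
apply/eqP => /(congr1 (fun s => fps_coef s 0%N)) /eqP.
by rewrite /= oner_eq0.
Qed.

HB.instance Definition _ := GRing.Zmodule_isComNzRing.Build (fps A)
  fps_mulA fps_mulC fps_mul1 fps_mulDl fps_oner_neq0.

(* The sum of a family with F m divisible by t^|m|: only the finitely many    *)
(* m with |m| <= d contribute to the coefficient of t^d (see fps_msumP).      *)
Definition fps_msum (n : nat) (F : 'X_{1..n} -> fps A) : fps A :=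
  Fps (fun d => \sum_(m : 'X_{1..n < d.+1}) fps_coef (F m) d).

Lemma fps_msumP (n : nat) (F : 'X_{1..n} -> fps A) (d : nat)
    (S : seq 'X_{1..n}) :
    (forall m k, (k < mdeg m)%N -> fps_coef (F m) k = 0) ->
    uniq S -> (forall m, (mdeg m <= d)%N -> m \in S) ->
  fps_coef (fps_msum F) d = \sum_(m <- S) fps_coef (F m) d.
Proof.
move=> F0 uS inS; rewrite (bigID (fun m => mdeg m < d.+1)%N) /=.
rewrite [X in _ + X]big1 ?addr0 => [|m]; last by rewrite -leqNgt => /F0.
rewrite -[RHS]big_filter.
rewrite -(big_map (@bmnm n d.+1) predT (fun m => fps_coef (F m) d)).
apply: perm_big; apply: uniq_perm.
- by rewrite map_inj_uniq ?index_enum_uniq //; exact: val_inj.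
- exact: filter_uniq.
move=> m; rewrite mem_filter; apply/mapP/andP => [[b _ ->]|[lt_md _]].
  by split; [exact: bmdeg | apply: inS; rewrite -ltnS bmdeg].
by exists (BMultinom lt_md); rewrite ?mem_index_enum.
Qed.

End FpsRing.

Definition fps_map (A B : Type) (phi : A -> B) (p : fps A) : fps B :=
  Fps (fun d => phi (fps_coef p d)).

(* f(t a) *)
Definition fps_dilate (R : nzRingType) (A : lalgType R) (f : fps R) (a : A) :
  fps A := Fps (fun d => fps_coef f d *: a ^+ d).

Inductive subring_gen (A : pzRingType) (X : A -> Prop) : A -> Prop :=
| Subring_gen_incl x of X x : subring_gen X x
| Subring_gen_one : subring_gen X 1
| Subring_gen_sub x y of subring_gen X x & subring_gen X y :
    subring_gen X (x - y)
| Subring_gen_mul x y of subring_gen X x & subring_gen X y :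
    subring_gen X (x * y).

Section CharacterRing.
Variables (gT : finGroupType) (G : {group gT}).
Implicit Type chi : 'CF(G).

(* The 'chi_i are pairwise distinct, so a sum of distinct irreducible         *)
(* characters is a sum over a set of indices.                                 *)
Definition multiplicity_free chi :=
  exists S : {set Iirr G}, chi = \sum_(i in S) 'chi_i.

Definition irr_value chi (x : algC) :=
  exists2 i, i \in irr_constt chi & exists2 g, g \in G & x = 'chi_i g.

Definition Rchi_pred chi : {pred algC} :=
  fun x => `[< subring_gen (irr_value chi) x >].

Record Rchi chi := MkRchi { Rchi_val : algC; _ : Rchi_val \in Rchi_pred chi }.

Fact Rchi_closed chi : subring_closed (Rchi_pred chi).
Proof.
split; rewrite ?unfold_in /=.
- by apply/asboolP; exact: Subring_gen_one.
- move=> x y /asboolP gx /asboolP gy; apply/asboolP.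
  exact: Subring_gen_sub.
- move=> x y /asboolP gx /asboolP gy; apply/asboolP.
  exact: Subring_gen_mul.
Qed.

HB.instance Definition _ chi := [isSub for @Rchi_val chi].
HB.instance Definition _ chi := [Choice of Rchi chi by <:].
HB.instance Definition _ chi :=
  GRing.SubChoice_isSubComNzRing.Build algC (Rchi_pred chi) (Rchi chi)
    (Rchi_closed chi).

(* Elements of the group algebra of gT, as coefficient functions.             *)
Definition galg_delta (g : gT) : {ffun gT -> algC} := [ffun h => (h == g)%:R].

Definition E_irr (i : Iirr G) : {ffun gT -> algC} :=
  [ffun h => 'chi_i 1%g * \sum_(g in G) 'chi_i g * galg_delta g^-1%g h].

Definition E_char chi : {ffun gT -> algC} :=
  \sum_(i in irr_constt chi) E_irr i.

End CharacterRing.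

(* Action of an element x of R_chi[G] through op, on a module over an         *)
(* R_chi-algebra.  insubd views a coefficient of x, a complex number, as an   *)
(* element of R_chi; E_char_in_Rchi and E_charC_in_Rchi show that its default *)
(* value 0 is never used.                                                     *)
Definition galg_act (gT : finGroupType) (G : {group gT}) (chi : 'CF(G))
    (R : comAlgType (Rchi chi)) (V : lmodType R) (op : gT -> V -> V)
    (x : {ffun gT -> algC}) (p : V) : V :=
  \sum_(g in G) (insubd (0 : Rchi chi) (x g))%:A *: op g p.

Section Coefficients.
Variables (gT : finGroupType) (G : {group gT}) (chi : 'CF(G)).

Lemma E_irrE (i : Iirr G) (h : gT) :
  E_irr i h = if h \in G then 'chi_i 1%g * 'chi_i h^-1%g else 0.
Proof.
rewrite ffunE; have [Gh|nGh] := boolP (h \in G).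
  rewrite (bigD1 h^-1%g) ?groupV //= ffunE invgK eqxx mulr1 big1 ?addr0 //.
  move=> g /andP[_ ne_g]; rewrite ffunE; case: eqP => [e|_]; last exact: mulr0.
  by case/eqP: ne_g; rewrite e invgK.
rewrite big1 ?mulr0 // => g Gg; rewrite ffunE; case: eqP => [e|_]; last first.
  exact: mulr0.
by case/negP: nGh; rewrite e groupV.
Qed.

Lemma Rchi_pred_sum (I : Type) (r : seq I) (P : pred I) (F : I -> algC) :
  (forall i, P i -> F i \in Rchi_pred chi) ->
  \sum_(i <- r | P i) F i \in Rchi_pred chi.
Proof.
move=> RF; have [_ closedB _] := Rchi_closed chi.
have R0 : 0 \in Rchi_pred chi.
  by rewrite -(subrr 1); apply: closedB; case: (Rchi_closed chi).
apply: (big_ind (fun x => x \in Rchi_pred chi)) => // x y Rx Ry.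
by rewrite -[y]opprK -[- y]sub0r; apply: (closedB) => //; exact: closedB.
Qed.

Lemma Rchi_pred_value i g :
  i \in irr_constt chi -> g \in G -> 'chi_i g \in Rchi_pred chi.
Proof.
move=> chi_i Gg; apply/asboolP; apply: Subring_gen_incl.
by exists i => //; exists g.
Qed.

Lemma E_char_in_Rchi (h : gT) : E_char chi h \in Rchi_pred chi.
Proof.
have [R1 RB RM] := Rchi_closed chi.
rewrite /E_char sum_ffunE; apply: Rchi_pred_sum => i chi_i; rewrite E_irrE.
case: ifP => Gh; last by rewrite -(subrr 1) RB.
by rewrite RM // Rchi_pred_value ?groupV.
Qed.

Lemma E_charC_in_Rchi (h : gT) : E_char (chi^*)%CF h \in Rchi_pred chi.
Proof.
have [R1 RB RM] := Rchi_closed chi.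
rewrite /E_char sum_ffunE; apply: Rchi_pred_sum => i chi_i; rewrite E_irrE.
case: ifP => Gh; last by rewrite -(subrr 1) RB.
have chi_i' : conjC_Iirr i \in irr_constt chi.
  move: chi_i; rewrite !irr_consttE conjC_IirrE.
  by rewrite -{1}['chi_i]cfConjCK cfdot_conjC fmorph_eq0.
have chiE g : 'chi_i g = 'chi_(conjC_Iirr i) g^-1%g.
  by rewrite char_inv ?irr_char // conjC_IirrE cfunE conjCK.
by rewrite !chiE invgK invg1 RM // Rchi_pred_value.
Qed.

End Coefficients.

(* R[u_1, ..., u_n, v_1, ..., v_n]: u takes the first n variables, v the last.*)
Section Variables.
Variables (n : nat) (R : comNzRingType).

Definition uvar (i : 'I_n) : {mpoly R[n + n]} := 'X_(lshift n i).
Definition vvar (i : 'I_n) : {mpoly R[n + n]} := 'X_(rshift n i).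

Definition umon (m : 'X_{1..n}) : {mpoly R[n + n]} :=
  \prod_(i < n) uvar i ^+ m i.
Definition vmon (m : 'X_{1..n}) : {mpoly R[n + n]} :=
  \prod_(i < n) vvar i ^+ m i.

Definition uact (g : signed_perm n) (p : {mpoly R[n + n]}) : {mpoly R[n + n]} :=
  p \mPo [tuple match split k with
          | inl i => (-1) ^+ sp_sgn g (sp_perm g i) * uvar (sp_perm g i)
          | inr j => vvar j
          end | k < n + n].

Definition vact (g : signed_perm n) (p : {mpoly R[n + n]}) : {mpoly R[n + n]} :=
  p \mPo [tuple match split k with
          | inl i => uvar i
          | inr j => (-1) ^+ sp_sgn g (sp_perm g j) * vvar (sp_perm g j)
          end | k < n + n].

End Variables.

Section Operators.
Variables (n : nat) (G : {group signed_perm n}) (chi : 'CF(G)).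
Variable R : comAlgType (Rchi chi).

Definition Eu (phi : 'CF(G)) (p : {mpoly R[n + n]}) : {mpoly R[n + n]} :=
  galg_act (@uact n R) (E_char phi) p.
Definition Ev (phi : 'CF(G)) (p : {mpoly R[n + n]}) : {mpoly R[n + n]} :=
  galg_act (@vact n R) (E_char phi) p.

End Operators.

(* Main.v *)
(* The kernel prod_i f(t u_i v_i) is invariant under g^u g^v, so g^u acts on  *)
(* it as (g^-1)^v; as the coefficient of E_chi at g^-1 is that of             *)
(* E_(conj chi) at g, this is the first equality.  By the orthogonality       *)
(* relations E_(conj chi) squares to |G| times itself, so |G| E_(conj chi)^v  *)
(* acts on the kernel as E_(conj chi)^v E_chi^u, and the second equality is   *)
(* read off the expansion sum_m t^|m| f_m u^m v^m of the kernel.              *)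
Require Import Defs.
From HB Require Import structures.
From mathcomp Require Import all_boot all_order all_algebra all_fingroup.
From mathcomp Require Import all_field all_character.
From mathcomp Require Import boolp.
From mathcomp Require Import mpoly.

Set Implicit Arguments.
Unset Strict Implicit.
Unset Printing Implicit Defensive.

Import Order.TTheory GRing.Theory Num.Theory.
Local Open Scope ring_scope.

(** Write P for the kernel. Applying $g$ to both sets of variables permutes the factors of P, so
    $g^u$ acts on P as $(g^{-1})^v$ ([uact_kernel]). Inverting group elements turns $E_\chi$ into
    $E_{\bar\chi}$ ([E_char_conjE]), whence $E_\chi^u P = E_{\bar\chi}^v P$ ([Eu_eq_Ev_conj]).

    Since $|G|$ may fail to be invertible in [R], no normalized idempotent is formed: orthogonality
    gives $E^2 = |G| E$ ([E_char_conv], [Ev_conj_idem]). Thus $|G| E_{\bar\chi}^v P = E_{\bar\chi}^v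
    E_\chi^u P$, and on each monomial of P ([coef_kernel]) the two operators act on separate factors
    ([Eu_umon_vmon], [Ev_Eu_umon_vmon]). *)

(** * Coefficients of $E_\chi$: conjugation and convolution *)

Lemma E_char_conjE (gT : finGroupType) (G : {group gT}) (chi : 'CF(G))
    (g : gT) :
  E_char chi^*%CF g = E_char chi g^-1%g.
Proof.
rewrite /E_char !sum_ffunE (reindex_inj (can_inj (@conjC_IirrK _ G))) /=.
apply: eq_big => [i|i _].
  by rewrite !irr_consttE conjC_IirrE cfdot_conjC fmorph_eq0.
have conjE h : 'chi_(conjC_Iirr i) h = 'chi_i h^-1%g.
  by rewrite char_inv ?irr_char // conjC_IirrE cfunE.
by rewrite !E_irrE groupV !conjE invg1.
Qed.

(** This is $E_\chi^2 = |G| E_\chi$ in coefficients. By generalized orthogonality the cross terms of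
    distinct constituents vanish, and each diagonal term contributes $|G| E_{\chi_i}$. *)
Lemma E_char_conv (gT : finGroupType) (G : {group gT}) (chi : 'CF(G)) (x : gT) :
  x \in G ->
  \sum_(g in G) E_char chi g * E_char chi (g^-1 * x)%g =
    #|G|%:R * E_char chi x.
Proof.
move=> Gx; have nzG : #|G|%:R != 0 :> algC := neq0CG G.
pose c (i j : Iirr G) g := 'chi_i 1%g * 'chi_j 1%g *
  ('chi_j (g * x^-1)%g * 'chi_i g^-1%g).
transitivity (\sum_(i in irr_constt chi) \sum_(j in irr_constt chi)
                \sum_(g in G) c i j g).
  under [RHS]eq_bigr do rewrite exchange_big.
  rewrite [RHS]exchange_big /=; apply: eq_bigr => g Gg.
  rewrite /E_char !sum_ffunE big_distrl /=; apply: eq_bigr => i _.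
  rewrite big_distrr /=; apply: eq_bigr => j _.
  rewrite !E_irrE Gg groupM ?groupV // invMg invgK /c.
  (* A class function takes the same value at $x^{-1}g$ and $gx^{-1}$; the latter is the form used
     by the orthogonality relation. *)
  rewrite -(cfunJ 'chi_j (x^-1 * g)%g (groupVr Gx)) conjgE invgK.
  by rewrite !mulgA mulgV mul1g mulrACA; congr (_ * _); rewrite mulrC.
rewrite /E_char sum_ffunE big_distrr /=; apply: eq_bigr => i chi_i.
have orth j : \sum_(g in G) c i j g =
    #|G|%:R * ((j == i)%:R * ('chi_j x^-1%g * 'chi_i 1%g)).
  rewrite -big_distrr /= -[X in _ * X](mulVKf nzG).
  rewrite (generalized_orthogonality_relation x^-1%g j i).
  case: eqP => [->|_]; last by rewrite !mul0r !mulr0.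
  rewrite !mul1r mulrCA; congr (_ * _).
  by rewrite mulrACA mulfV ?irr1_neq0 // mulr1 mulrC.
rewrite (bigD1 i) //= [X in _ + X]big1 ?addr0 => [|j /andP[_ /negPf ne_ji]].
  by rewrite orth eqxx mul1r E_irrE Gx mulrC ['chi_i 1%g * _]mulrC mulrC.
by rewrite orth ne_ji mul0r mulr0.
Qed.

(** * Group algebra elements acting on a module *)

Section GroupAlgebraAction.
Variables (gT : finGroupType) (G : {group gT}) (chi : 'CF(G)).
Variables (R : comAlgType (Rchi chi)) (V : lmodType R).
Variable op : gT -> {linear V -> V}.

Lemma galg_act_lincomb (I : finType) (Q : pred I) (x : {ffun gT -> algC})
    (c : I -> R) (F : I -> V) :
  galg_act op x (\sum_(i | Q i) c i *: F i) =
    \sum_(i | Q i) c i *: galg_act op x (F i).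
Proof.
under [RHS]eq_bigr do rewrite /galg_act scaler_sumr.
rewrite exchange_big; apply: eq_bigr => g _.
rewrite linear_sum scaler_sumr; apply: eq_bigr => i _.
by rewrite linearZ !scalerA mulrC.
Qed.

Lemma galg_act_idem (x : {ffun gT -> algC}) (p : V) :
    (forall g h q, op (g * h)%g q = op g (op h q)) ->
    (forall g, x g \in Rchi_pred chi) ->
    {in G, forall h, \sum_(g in G) x g * x (g^-1 * h)%g = #|G|%:R * x h} ->
  galg_act op x (galg_act op x p) = galg_act op x p *+ #|G|.
Proof.
move=> opM Rx conv_x; pose c g : Rchi chi := insubd 0 (x g).
have cE g : val (c g) = x g by rewrite insubdK.
(* The complex identity descends to [Rchi chi] because [val] is injective; [Rx] ensures that
   [insubd] never falls back on 0. *)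
have conv_c h : h \in G ->
    \sum_(g in G) c g * c (g^-1 * h)%g = #|G|%:R * c h.
  move=> Gh; apply: val_inj; rewrite rmorph_sum rmorphM rmorph_nat.
  rewrite [X in _ = _ * X]cE -conv_x //; apply: eq_bigr => g _.
  by rewrite rmorphM -!cE.
rewrite /galg_act -/(c _).
(* Collecting terms by the product of the two group elements, now called [h], makes its coefficient
   a convolution. *)
transitivity (\sum_(g in G) \sum_(h in G) (c g * c (g^-1 * h)%g)%:A *: op h p).
  apply: eq_bigr => g Gg; rewrite linear_sum scaler_sumr /=.
  rewrite [RHS](reindex_inj (mulgI g)); apply: eq_big => [h|h Gh].
    by rewrite groupMl.
  by rewrite linearZ scalerA -opM mulKg -scalerAl mul1r scalerA.
rewrite exchange_big -sumrMnl; apply: eq_bigr => h Gh.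
rewrite -scaler_suml -scaler_suml conv_c // mulr_natl.
by rewrite -!scalerMnl.
Qed.

End GroupAlgebraAction.

(** * Coefficients of products of power series *)

Section FpsProducts.
Variable A : comNzRingType.

(** Coefficient [k] of a product involves only coefficients of index at most [k], so truncation at
    degree [D] is harmless up to [D]. *)
Lemma fps_coefM_eq (D : nat) (p q : fps A) (p' q' : {poly A}) :
    (forall k, (k <= D)%N -> fps_coef p k = p'`_k) ->
    (forall k, (k <= D)%N -> fps_coef q k = q'`_k) ->
  forall k, (k <= D)%N -> fps_coef (p * q) k = (p' * q')`_k.
Proof.
move=> eq_p eq_q k le_kD; rewrite coefM; apply: eq_bigr => -[j /= le_jk] _.
rewrite eq_p ?eq_q //; first exact: leq_trans (leq_subr _ _) le_kD.
by rewrite ltnS in le_jk; exact: leq_trans le_jk le_kD.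
Qed.

Lemma fps_coef_prod (n d : nat) (F : 'I_n -> fps A) :
  fps_coef (\prod_(i < n) F i) d =
    \sum_(m : {ffun 'I_n -> 'I_d.+1} | (\sum_(i < n) m i)%N == d)
      \prod_(i < n) fps_coef (F i) (m i).
Proof.
(* The F i truncated to polynomials have the same product up to degree d. *)
pose T i := \poly_(k < d.+1) fps_coef (F i) k.
have: forall k, (k <= d)%N -> fps_coef (\prod_(i < n) F i) k =
                              (\prod_(i < n) T i)`_k.
  apply: (big_rec2 (fun (p : fps A) (p' : {poly A}) =>
            forall k, (k <= d)%N -> fps_coef p k = p'`_k)).
    by move=> k _; rewrite coef1; case: k.
  move=> i p' p _ eq_p; apply: fps_coefM_eq => // k le_kd.
  by rewrite coef_poly ltnS le_kd.
move/(_ d (leqnn d)) ->.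
have TE i : T i = \sum_(k < d.+1) fps_coef (F i) k *: 'X^k.
  by rewrite /T poly_def.
under eq_bigr do rewrite TE.
rewrite bigA_distr_bigA /= coef_sum [RHS]big_mkcond /=.
apply: eq_bigr => m _; rewrite scaler_prod prodrXr coefZ coefXn eq_sym.
by case: eqP; rewrite ?mulr1 ?mulr0.
Qed.

Lemma fps_coef_XnC (k d : nat) (a : A) :
  fps_coef (fpsX A ^+ k * fpsC a) d = if d == k then a else 0.
Proof.
elim: k d => [|k IHk] d; first by rewrite expr0 mul1r; case: d.
rewrite exprS -mulrA [LHS]big_ord_recl [fps_coef _ _ * _]mul0r add0r.
case: d => [|d]; first by rewrite big_ord0.
rewrite big_ord_recl big1 => [|i _]; last exact: mul0r.
by rewrite addr0 [LHS]mul1r subSS subn0 eqSS IHk.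
Qed.

Lemma fps_coef_msumXC (n d : nat) (F : 'X_{1..n} -> A) :
  fps_coef (fps_msum (fun m => fpsX A ^+ mdeg m * fpsC (F m))) d =
    \sum_(m : 'X_{1..n < d.+1} | mdeg m == d) F m.
Proof.
rewrite [RHS]big_mkcond; apply: eq_bigr => m _.
by rewrite fps_coef_XnC eq_sym.
Qed.

Lemma fps_coef_prod_mnm (n d : nat) (F : 'I_n -> fps A) :
  fps_coef (\prod_(i < n) F i) d =
    \sum_(m : 'X_{1..n < d.+1} | mdeg m == d)
      \prod_(i < n) fps_coef (F i) ((m : 'X_{1..n}) i).
Proof.
have lt_m (m : 'X_{1..n < d.+1}) i : ((m : 'X_{1..n}) i < d.+1)%N.
  by apply: leq_ltn_trans (bmdeg m); rewrite mdegE (bigD1 i) ?leq_addr.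
rewrite fps_coef_prod.
pose h (m : 'X_{1..n < d.+1}) : {ffun 'I_n -> 'I_d.+1} :=
  [ffun i => Ordinal (lt_m m i)].
(* Inverse to [h] on exponents of total degree [d]; the default [bm0] arises only for total degree
   above [d]. *)
pose k (m : {ffun 'I_n -> 'I_d.+1}) : 'X_{1..n < d.+1} :=
  insubd bm0 [multinom nat_of_ord (m i) | i < n].
rewrite (reindex_onto h k) /= => [|m /eqP md].
  apply: eq_big => [m|m _]; last by apply: eq_bigr => i _; rewrite ffunE.
  rewrite mdegE; under eq_bigr do rewrite ffunE.
  case: eqP => //= md; apply/eqP; apply: val_inj.
  have hm : [multinom nat_of_ord (h m i) | i < n] = m.
    by apply/mnmP => i; rewrite mnmE ffunE.
  by rewrite /k hm insubdK // -topredE /= bmdeg.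
apply/ffunP => i; apply: val_inj; rewrite ffunE /= insubdK ?mnmE //.
by rewrite -topredE /= mdegE; under eq_bigr do rewrite mnmE; rewrite md.
Qed.

Lemma fps_map_prod (phi : {rmorphism A -> A}) (n : nat) (F : 'I_n -> fps A) :
  fps_map phi (\prod_(i < n) F i) = \prod_(i < n) fps_map phi (F i).
Proof.
apply: (big_morph (fps_map phi)) => [p q|]; apply: fpsP => d /=.
  by rewrite rmorph_sum; apply: eq_bigr => j _; rewrite rmorphM.
by case: d => [|d]; rewrite ?rmorph1 ?rmorph0.
Qed.

End FpsProducts.

(** * Signed permutations of the variables, and the kernel *)

Section VariableActions.
Variables (n : nat) (R : comNzRingType).
Implicit Types g h : signed_perm n.

HB.instance Definition _ g :=
  GRing.LRMorphism.copy (@uact n R g) (comp_mpoly _).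
HB.instance Definition _ g :=
  GRing.LRMorphism.copy (@vact n R g) (comp_mpoly _).

Lemma uact_uvar g i :
  uact g (uvar R i) = (-1) ^+ sp_sgn g (sp_perm g i) * uvar R (sp_perm g i).
Proof.
by rewrite /uact [in LHS]/uvar comp_mpolyXU -tnth_nth tnth_mktuple
  (unsplitK (inl i)).
Qed.

Lemma uact_vvar g i : uact g (vvar R i) = vvar R i.
Proof.
by rewrite /uact [in LHS]/vvar comp_mpolyXU -tnth_nth tnth_mktuple
  (unsplitK (inr i)).
Qed.

Lemma vact_uvar g i : vact g (uvar R i) = uvar R i.
Proof.
by rewrite /vact [in LHS]/uvar comp_mpolyXU -tnth_nth tnth_mktuple
  (unsplitK (inl i)).
Qed.

Lemma vact_vvar g i :
  vact g (vvar R i) = (-1) ^+ sp_sgn g (sp_perm g i) * vvar R (sp_perm g i).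
Proof.
by rewrite /vact [in LHS]/vvar comp_mpolyXU -tnth_nth tnth_mktuple
  (unsplitK (inr i)).
Qed.

Lemma lrmorphism_mpoly_ext
    (phi psi : {lrmorphism {mpoly R[n + n]} -> {mpoly R[n + n]}}) :
    (forall i, phi (uvar R i) = psi (uvar R i)) ->
    (forall i, phi (vvar R i) = psi (vvar R i)) ->
  phi =1 psi.
Proof.
move=> eq_u eq_v p; rewrite [p]mpolyE !linear_sum; apply: eq_bigr => m _.
rewrite !linearZ; congr (_ *: _).
rewrite mpolyXE_id !rmorph_prod; apply: eq_bigr => i _; rewrite !rmorphXn.
case: (split_ordP i) => j ->; congr (_ ^+ _); first exact: eq_u.
exact: eq_v.
Qed.

Lemma uactM g h p : uact (g * h)%g p = uact g (uact h p) :> {mpoly R[n + n]}.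
Proof.
apply: (lrmorphism_mpoly_ext (phi := uact (g * h)%g)
                            (psi := uact g \o uact h)).
  move=> i /=; rewrite !uact_uvar rmorphM rmorph_sign /= uact_uvar /= ffunE.
  by rewrite permM permK signr_addb mulrCA mulrA.
by move=> i /=; rewrite !uact_vvar.
Qed.

Lemma vactM g h p : vact (g * h)%g p = vact g (vact h p) :> {mpoly R[n + n]}.
Proof.
apply: (lrmorphism_mpoly_ext (phi := vact (g * h)%g)
                            (psi := vact g \o vact h)).
  by move=> i /=; rewrite !vact_uvar.
move=> i /=; rewrite !vact_vvar rmorphM rmorph_sign /= vact_vvar /= ffunE permM.
by rewrite permK signr_addb mulrCA mulrA.
Qed.

Lemma vact1 p : vact 1%g p = p :> {mpoly R[n + n]}.
Proof.
apply: (lrmorphism_mpoly_ext (phi := vact 1%g)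
                            (psi := idfun)) => i /=.
  exact: vact_uvar.
by rewrite vact_vvar /= ffunE perm1 mul1r.
Qed.

Lemma uact_vact g h p :
  uact g (vact h p) = vact h (uact g p) :> {mpoly R[n + n]}.
Proof.
apply: (lrmorphism_mpoly_ext (phi := uact g \o vact h)
                            (psi := vact h \o uact g)).
  by move=> i /=; rewrite uact_uvar rmorphM rmorph_sign /= !vact_uvar uact_uvar.
by move=> i /=; rewrite uact_vvar !vact_vvar rmorphM rmorph_sign /= uact_vvar.
Qed.

Lemma vact_umon g m : vact g (umon R m) = umon R m.
Proof.
by rewrite rmorph_prod; apply: eq_bigr => i _; rewrite rmorphXn /= vact_uvar.
Qed.

Lemma uact_vmon g m : uact g (vmon R m) = vmon R m.
Proof.
by rewrite rmorph_prod; apply: eq_bigr => i _; rewrite rmorphXn /= uact_vvar.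
Qed.

Variable f : fps R.
Let P : fps {mpoly R[n + n]} :=
  \prod_(i < n) fps_dilate f (uvar R i * vvar R i).

(** Under $g^u g^v$ the two signs cancel, so $u_i v_i \mapsto u_{\sigma(i)} v_{\sigma(i)}$ and the
    factors of [P] are merely permuted. *)
Lemma uact_kernel g d : uact g (fps_coef P d) = vact g^-1%g (fps_coef P d).
Proof.
suff inv_P : vact g (uact g (fps_coef P d)) = fps_coef P d.
  by rewrite -[in RHS]inv_P -vactM mulVg vact1.
suff: fps_map (vact g \o uact g) P = P by move/(congr1 (fun p => fps_coef p d)).
rewrite fps_map_prod [RHS](reindex_inj (@perm_inj _ (sp_perm g))) /=.
apply: eq_bigr => i _; apply: fpsP => k /=.
rewrite !linearZ !rmorphXn !rmorphM /= uact_uvar uact_vvar rmorphM.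
by rewrite rmorph_sign /= vact_uvar vact_vvar mulrACA -signr_addb addbb mul1r.
Qed.

Lemma coef_kernel d :
  fps_coef P d = \sum_(m : 'X_{1..n < d.+1} | mdeg m == d)
    (\prod_(i < n) fps_coef f ((m : 'X_{1..n}) i)) *: (umon R m * vmon R m).
Proof.
rewrite fps_coef_prod_mnm; apply: eq_bigr => m _.
rewrite scaler_prod -big_split; congr (_ *: _); apply: eq_bigr => i _.
exact: exprMn.
Qed.

End VariableActions.

(** * The operators $E^u$ and $E^v$ on monomials and on the kernel *)

Section Projectors.
Variables (n : nat) (G : {group signed_perm n}) (chi : 'CF(G)).
Variable R : comAlgType (Rchi chi).
Implicit Types (phi : 'CF(G)) (m : 'X_{1..n}) (p : {mpoly R[n + n]}).

Lemma Eu_lincomb (I : finType) (Q : pred I) phi (c : I -> R)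
    (F : I -> {mpoly R[n + n]}) :
  Eu phi (\sum_(i | Q i) c i *: F i) = \sum_(i | Q i) c i *: Eu phi (F i).
Proof. exact: (galg_act_lincomb (fun g => @uact n R g)). Qed.

Lemma Ev_lincomb (I : finType) (Q : pred I) phi (c : I -> R)
    (F : I -> {mpoly R[n + n]}) :
  Ev phi (\sum_(i | Q i) c i *: F i) = \sum_(i | Q i) c i *: Ev phi (F i).
Proof. exact: (galg_act_lincomb (fun g => @vact n R g)). Qed.

Lemma Eu_umon_vmon phi m :
  Eu phi (umon R m * vmon R m) = Eu phi (umon R m) * vmon R m.
Proof.
rewrite /Eu /galg_act mulr_suml; apply: eq_bigr => g _.
by rewrite rmorphM /= uact_vmon scalerAl.
Qed.

(** The two actions commute and $g^v$ fixes $u^m$, so it fixes $E^u(u^m)$, which therefore passes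
    through $E^v$ as a scalar. *)
Lemma Ev_Eu_umon_vmon phi psi m :
  Ev phi (Eu psi (umon R m) * vmon R m) = Eu psi (umon R m) * Ev phi (vmon R m).
Proof.
rewrite [Ev _ _ in LHS]/Ev /galg_act mulr_sumr; apply: eq_bigr => g _.
rewrite rmorphM /= -scalerAr; congr (_ *: (_ * _)).
rewrite /Eu /galg_act linear_sum; apply: eq_bigr => h _.
by rewrite linearZ /= -uact_vact vact_umon.
Qed.

Lemma Ev_conj_idem p :
  Ev chi^*%CF (Ev chi^*%CF p) = Ev chi^*%CF p *+ #|G|.
Proof.
apply: (galg_act_idem (op := fun g => @vact n R g)) => [g h q|g|g Gg].
- exact: vactM.
- exact: E_charC_in_Rchi.
exact: E_char_conv.
Qed.

Lemma Eu_eq_Ev_conj p :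
  (forall g, uact g p = vact g^-1%g p) -> Eu chi p = Ev chi^*%CF p.
Proof.
move=> inv_p; rewrite /Ev /galg_act (reindex_inj invg_inj) /=.
apply: eq_big => [g|g _]; first by rewrite groupV.
by rewrite E_char_conjE invgK inv_p.
Qed.

End Projectors.

Theorem theorem2p2 (n : nat) (hn : (0 < n)%N) (G : {group signed_perm n})
    (chi : 'CF(G)) (hchi : multiplicity_free chi)
    (R : comAlgType (Rchi chi)) (f : fps R) :
  let P : fps {mpoly R[n + n]} :=
    \prod_(i < n) fps_dilate f (uvar R i * vvar R i) in
  fps_map (Eu chi) P *+ #|G| = fps_map (Ev (chi^*)%CF) P *+ #|G| /\
  fps_map (Ev (chi^*)%CF) P *+ #|G| =
    fps_msum (fun m : 'X_{1..n} =>
      fpsX _ ^+ mdeg m *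
      fpsC ((\prod_(i < n) fps_coef f (m i)) *:
            (Eu chi (umon R m) * Ev (chi^*)%CF (vmon R m)))).
Proof.
move=> P; have EuP d : Eu chi (fps_coef P d) = Ev chi^*%CF (fps_coef P d).
  by apply: Eu_eq_Ev_conj => g; exact: uact_kernel.
split.
  by apply: (congr1 (fun q => q *+ #|G|)); apply: fpsP => d; exact: EuP.
have coefMn (p : fps {mpoly R[n + n]}) k d :
    fps_coef (p *+ k) d = fps_coef p d *+ k.
  by elim: k => [|k IHk]; [case: d | rewrite !mulrS -IHk].
(* The factor $|G|$ is traded for a second copy of $E_{\bar\chi}^v$, and the inner copy is then
   replaced by $E_\chi^u$. *)
apply: fpsP => d; rewrite coefMn fps_coef_msumXC -Ev_conj_idem -EuP.
rewrite coef_kernel Eu_lincomb Ev_lincomb; apply: eq_bigr => m _.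
by rewrite Eu_umon_vmon Ev_Eu_umon_vmon.
Qed.
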